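(* Let $l\ge 2$ be an integer and let $\lambda$ be a partition of $n$. Let $r_1<r_2<\dots<r_m$ be the row numbers of the rows of $\lambda$ from which a node can be removed to leave a Young diagram. Fix $i\in\{1,\dots,m\}$, let $\gamma=(r_i,c)$ with $c=\lambda_{r_i}$ be the last node of row $r_i$, let $\mu=\lambda^i$ be the partition with $\lambda\setminus\mu=\{\gamma\}$, and let $k\in\mathbb Z/l\mathbb Z$ be the residue of $\gamma$. Then $$N_k^r(\lambda,\mu)=\nu_q(m_i^2).$$
   Context: Partitions are identified with Young diagrams, with nodes $(a,b)$ (row $a$, column $b$, rows numbered from top to bottom). The residue of a node $(a,b)$ is $b-a \bmod l$; a node of residue $k$ is called a $k$-node. A removable node of $\lambda$ is a node of the diagram whose removal leaves a Young diagram; an indent node of $\lambda$ is a node not in the diagram whose addition gives a Young diagram. For $\mu\subset\lambda$ with $\lambda\setminus\mu$ a single node $\gamma$ of residue $k$, let $I_k^r(\lambda,\mu)$ (resp. $R_k^r(\lambda,\mu)$) be the number of indent (resp. removable) $k$-nodes of $\lambda$ situated to the right of $\gamma$ (i.e. in strictly larger columns, equivalently in rows above that of $\gamma$), and put $N_k^r(\lambda,\mu)=I_k^r(\lambda,\mu)-R_k^r(\lambda,\mu)$. The numbers $m_i^2$: over $\mathbb Q$, let $M(\lambda)$ be the permutation module of $S_n$ with basis the $\lambda$-tabloids, with the invariant form $\langle\cdot,\cdot\rangle_\lambda$ making the tabloids orthonormal, and let $S(\lambda)\subset M(\lambda)$ be the Specht module spanned by $e_t=\sum_{\pi\in C_t}\mathrm{sign}(\pi)\{t\pi\}$,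 where $C_t$ is the column stabilizer of the $\lambda$-tableau $t$. Let $V_i\subset S(\lambda)$ be the span of the $e_t$, $t$ standard with $n$ in one of the rows $r_1,\dots,r_i$; then $V_i/V_{i-1}\cong S(\lambda^i)$ as $S_{n-1}$-modules, via $e_t\mapsto e_{t'}$, $t'$ being $t$ (with $n$ in row $r_i$) with the node containing $n$ removed. Let $U_i$ be the orthogonal complement of $V_{i-1}$ in $V_i$. The restriction of $\langle\cdot,\cdot\rangle_\lambda$ to $U_i$ is a scalar $m_i^2$ times the pullback of $\langle\cdot,\cdot\rangle_{\lambda^i}$ along $U_i\cong V_i/V_{i-1}\cong S(\lambda^i)$, and by a theorem of James and Murphy $$m_i^2=\prod_{a=1}^{r_i-1}\frac{H_{ac}}{H_{ac}-1},$$ where $H_{ac}$ is the hook length in $\lambda$ of the node $(a,c)$. The quantum $l$-adic valuation $\nu_q(m_i^2)$ is defined from this product by $$\nu_q(m_i^2)=\nu_{\mathfrak p}\Bigl(\prod_{a=1}^{r_i-1}\frac{[H_{ac}]}{[H_{ac}-1]}\Bigr),$$ where $[h]=1+q+\dots+q^{h-1}$ (equal to the Gaussian integer $\frac{v^h-v^{-h}}{v-v^{-1}}$ with $q=v^2$, up to a power of $v$) and $\nu_{\mathfrak p}$ is the valuation on $\mathbb Q(q)$ with respect to the $l$-th cyclotomic polynomial $\Phi_l(q)$. Thus $\nu_{\mathfrak p}([h])$ is $1$ if $l\mid h$ and $0$ otherwise, for $h\ge 1$. *)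

(* Defs.v *)
From HB Require Import structures.
From mathcomp Require Export all_boot all_order all_algebra all_field.
From mathcomp Require Export generic_quotient fraction finmap.
From mathcomp Require Import zify.

Set Implicit Arguments.
Unset Strict Implicit.
Unset Printing Implicit Defensive.

Import GRing.Theory.

Local Open Scope fset_scope.

(* Partitions are weakly decreasing sequences of positive integers.  Rows,
   columns and parts are numbered from 1. *)
Definition is_partition (lam : seq nat) : bool :=
  sorted geq lam && (0 \notin lam).

Definition part (lam : seq nat) (a : nat) : nat := nth 0 lam a.-1.

(* A node is a pair (row, column). *)
Definition node := (nat * nat)%type.

Definition box (m n : nat) : seq node :=
  [seq (a, b) | a <- iota 1 m, b <- iota 1 n].

Definition diagram (lam : seq nat) : {fset node} :=
  [fset x in [seq (a, b) | a <- iota 1 (size lam), b <- iota 1 (part lam a)]].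

(* D is a Young diagram: its nodes have positive coordinates, and D contains
   every node weakly above and weakly to the left of any of its nodes.
   By youngP below these are exactly the diagrams of partitions. *)
Definition young (D : {fset node}) : bool :=
  all (fun x => [&& 0 < x.1, 0 < x.2 & all (fun y => y \in D) (box x.1 x.2)])
      (enum_fset D).

Definition removable_nodes (D : {fset node}) : {fset node} :=
  [fset x in D | young (D `\ x)].

(* Candidates for indent nodes are searched in a finite set; in_indent_nodes
   below shows that this restriction loses nothing. *)
Definition indent_nodes (D : {fset node}) : {fset node} :=
  [fset x in (1, 1) |` ([fset (y.1.+1, y.2) | y in D]
                        `|` [fset (y.1, y.2.+1) | y in D])
   | (x \notin D) && young (x |` D)].

Definition residue (l : nat) (x : node) : 'Z_l := (x.2%:R - x.1%:R)%R.

(* x lies in a strictly larger column than the nodes of lam \ mu. *)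
Definition right_of (lam mu : seq nat) (x : node) : bool :=
  all (fun y => y.2 < x.2) (enum_fset (diagram lam `\` diagram mu)).

Definition I_right (l : nat) (k : 'Z_l) (lam mu : seq nat) : nat :=
  #|` [fset x in indent_nodes (diagram lam)
       | (residue l x == k) && right_of lam mu x] |.

Definition R_right (l : nat) (k : 'Z_l) (lam mu : seq nat) : nat :=
  #|` [fset x in removable_nodes (diagram lam)
       | (residue l x == k) && right_of lam mu x] |.

Definition N_right (l : nat) (k : 'Z_l) (lam mu : seq nat) : int :=
  ((I_right k lam mu)%:Z - (R_right k lam mu)%:Z)%R.

(* r_1 < ... < r_m *)
Definition removable_rows (lam : seq nat) : seq nat :=
  [seq a <- iota 1 (size lam)
   | has (fun b => (a, b) \in removable_nodes (diagram lam))
         (iota 1 (part lam a))].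

Definition removable_row (lam : seq nat) (i : nat) : nat :=
  nth 0 (removable_rows lam) i.-1.

(* The hook of x consists of x and the nodes to its right or below it. *)
Definition hook_length (lam : seq nat) (x : node) : nat :=
  #|` [fset y in diagram lam | ((y.1 == x.1) && (x.2 <= y.2))
                            || ((y.2 == x.2) && (x.1 <= y.1))] |.

Local Open Scope ring_scope.

(* The field Q(q), q being the indeterminate of {poly rat}. *)
Definition Qq := {fraction {poly rat}}.

Definition q_var : Qq := tofrac 'X.

Definition q_int (h : nat) : Qq := \sum_(0 <= j < h) q_var ^+ j.

(* The multiplicity of P in f, for f != 0 and P nonconstant (then
   P ^+ e %| f forces e < size f). *)
Definition poly_mult (P f : {poly rat}) : nat :=
  \max_(e < size f | P ^+ e %| f) e.

(* The valuation on Q(q) attached to an irreducible polynomial P.  For x != 0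
   and P irreducible it does not depend on the representative of x; the value
   at 0, where the valuation is infinite, is irrelevant. *)
Definition val_at (P : {poly rat}) (x : Qq) : int :=
  (poly_mult P \n_(repr x))%:Z - (poly_mult P \d_(repr x))%:Z.

Definition Phi_rat (l : nat) : {poly rat} := map_poly intr 'Phi_l.

(* nu_q (m_i^2) is by definition the valuation of the q-analogue of the
   James-Murphy product for m_i^2, the ratio between the invariant forms of
   the Specht modules of lam^i and of lam on the i-th layer of the restriction
   of S(lam). *)
Definition nu_q_m2 (l : nat) (lam : seq nat) (i : nat) : int :=
  let r := removable_row lam i in
  let c := part lam r in
  val_at (Phi_rat l)
    (\prod_(1 <= a < r) (q_int (hook_length lam (a, c))
                         / q_int (hook_length lam (a, c) - 1)%N)).

Local Close Scope ring_scope.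

Lemma mem_box m n (x : node) :
  (x \in box m n) = [&& 0 < x.1, x.1 <= m, 0 < x.2 & x.2 <= n].
Proof.
apply/allpairsP/and4P => [[[a b]] /= [] | []].
  by rewrite !mem_iota !add1n !ltnS => /andP[? ?] /andP[? ?] ->.
case: x => a b /= ? ? ? ?; exists (a, b).
by rewrite !mem_iota !add1n !ltnS /=; split=> //; apply/andP; split.
Qed.

Lemma mem_diagram lam (x : node) :
  (x \in diagram lam) = [&& 0 < x.1, 0 < x.2 & x.2 <= part lam x.1].
Proof.
case: x => a b /=; rewrite inE; apply/allpairsPdep/and3P => /=.
  case=> a' [b' []]; rewrite !mem_iota !add1n !ltnS.
  by move=> /andP[a0 _] /andP[b0 bl] [-> ->].
move=> [a0 b0 bl]; exists a, b; rewrite !mem_iota !add1n !ltnS a0 b0 bl /=.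
split=> //; rewrite leqNgt; apply/negP => al.
move: bl; rewrite /part nth_default ?leqn0; last by case: a a0 al.
by move=> /eqP b00; rewrite b00 in b0.
Qed.

Lemma youngE (D : {fset node}) :
  young D <->
  forall x, x \in D -> [/\ 0 < x.1, 0 < x.2 &
    forall y : node, 0 < y.1 <= x.1 -> 0 < y.2 <= x.2 -> y \in D].
Proof.
split=> [/allP yD x xD | yD]; last first.
  apply/allP => x xD; have [-> -> yx] := yD x xD.
  apply/allP => y; rewrite mem_box => /and4P[? ? ? ?].
  by apply: yx; apply/andP.
have /and3P[-> -> /allP bD] := yD x xD; split=> // y /andP[? ?] /andP[? ?].
by apply: bD; rewrite mem_box; apply/and4P.
Qed.

Lemma part_anti lam a b : is_partition lam -> 0 < a <= b ->
  part lam b <= part lam a.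
Proof.
move=> /andP[slam _] /andP[a0 ab].
have [bl | lb] := ltnP b.-1 (size lam); last by rewrite [part lam b]nth_default.
have geT : transitive geq by move=> x y z /= xy zx; apply: leq_trans zx xy.
have := sorted_leq_nth geT leqnn 0 slam; apply; rewrite ?inE //.
  by apply: leq_ltn_trans bl; case: a b a0 ab => [|a] [|b].
by case: a b a0 ab {bl} => [|a] [|b].
Qed.

Lemma young_diagram lam : is_partition lam -> young (diagram lam).
Proof.
move=> plam; apply/youngE => x; rewrite mem_diagram => /and3P[x1 x2 xl].
split=> // y /andP[y1 yx1] /andP[y2 yx2]; rewrite mem_diagram y1 y2 /=.
apply: leq_trans yx2 (leq_trans xl _).
by apply: part_anti => //; rewrite y1.
Qed.

Lemma youngP (D : {fset node}) :
  reflect (exists2 lam, is_partition lam & D = diagram lam) (young D).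
Proof.
apply: (iffP idP) => [yD | [lam plam ->]]; last exact: young_diagram.
have /youngE yD' := yD.
pose n := \max_(x <- enum_fset D) maxn x.1 x.2.
have len x : x \in D -> (x.1 <= n) && (x.2 <= n).
  by move=> xD; rewrite -geq_max; apply: (@leq_bigmax_seq _ _ _ (fun x => maxn x.1 x.2)).
pose w a := count (fun b => (a, b) \in D) (iota 1 n).
have wP a b : ((a, b) \in D) = (0 < b <= w a).
  have down b1 b2 : 0 < b1 <= b2 -> (a, b2) \in D -> (a, b1) \in D.
    by move=> b12 /yD'[/= a0 b0]; apply; rewrite //= a0 leqnn.
  have wE m : count (fun b => (a, b) \in D) (iota 1 m) <= m.
    by rewrite -[leqRHS](size_iota 1) count_size.
  have wT m : (a, m) \in D -> count (fun b => (a, b) \in D) (iota 1 m) = m.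
    move=> mD; rewrite -[RHS](size_iota 1); apply/eqP.
    rewrite -all_count; apply/allP => b'; rewrite mem_iota add1n ltnS => bm.
    exact: down bm mD.
  apply/idP/andP => [bD | [b0 bw]].
    have [_ b0 _] := yD' _ bD; have /andP[_ bn] := len _ bD; split=> //.
    by rewrite /w -(subnKC bn) iotaD count_cat /= (wT b) ?leq_addr.
  apply: contraLR bw => bD; rewrite -ltnNge.
  have bn : b.-1 <= n \/ n < b by case: (ltnP n b) => h; [right|left; lia].
  case: bn => [bn | nb]; last by apply: leq_ltn_trans nb; apply: wE.
  rewrite /w -(subnKC bn) iotaD count_cat.
  rewrite [X in (_ + X)%N](_ : _ = 0) ?addn0; first by have := wE b.-1; lia.
  apply/eqP; rewrite -leqn0 leqNgt -has_count; apply/hasPn => b'.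
  rewrite mem_iota => /andP[bb' _]; apply: contra bD; apply: down; lia.
have w_anti a a' : 0 < a <= a' -> w a' <= w a.
  move=> aa'; case: (posnP (w a')) => [-> // | w0].
  have : (a', w a') \in D by rewrite wP w0 /=.
  move=> /yD'[/= _ _ /(_ (a, w a')) /= dn].
  by have := dn aa'; rewrite w0 leqnn wP => /(_ isT) /andP[].
pose m := count (fun a => 0 < w a) (iota 1 n).
have wpos a : 0 < a -> (0 < w a) = (a <= m).
  move=> a0.
  have wE p : count (fun a => 0 < w a) (iota 1 p) <= p.
    by rewrite -[leqRHS](size_iota 1) count_size.
  have wT p : 0 < w p -> count (fun a => 0 < w a) (iota 1 p) = p.
    move=> wp; rewrite -[RHS](size_iota 1); apply/eqP.
    rewrite -all_count; apply/allP => a'; rewrite mem_iota add1n ltnS => ap.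
    exact: leq_trans wp (w_anti _ _ ap).
  apply/idP/idP => [wa | am].
    have : (a, w a) \in D by rewrite wP wa /=.
    move=> /len /andP[/= an _].
    by rewrite /m -(subnKC an) iotaD count_cat /= wT ?leq_addr.
  apply: contraLR am => wa; rewrite -ltnNge.
  have bn : a.-1 <= n \/ n < a by case: (ltnP n a) => h; [right|left; lia].
  case: bn => [bn | nb]; last by apply: leq_ltn_trans nb; apply: wE.
  rewrite /m -(subnKC bn) iotaD count_cat.
  rewrite [X in (_ + X)%N](_ : _ = 0) ?addn0; first by have := wE a.-1; lia.
  apply/eqP; rewrite -leqn0 leqNgt -has_count; apply/hasPn => a'.
  rewrite mem_iota => /andP[aa' _]; apply: contra wa => wa'.
  by apply: leq_trans wa' (w_anti _ _ _); lia.
exists [seq w a | a <- iota 1 m].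
  apply/andP; split; last first.
    apply/mapP => -[a]; rewrite mem_iota add1n ltnS => /andP[a0 am] w0.
    by move: am; rewrite -wpos // -w0.
  apply: (@homo_sorted_in _ _ (fun a => 0 < a) w ltn).
  - by move=> a b; rewrite /in_mem /= => a0 b0 ab; apply: w_anti; lia.
  - by apply/allP => a; rewrite mem_iota => /andP[].
  - exact: iota_ltn_sorted.
apply/fsetP => -[a b]; rewrite mem_diagram /= wP.
case: (posnP a) => [-> | a0] /=.
  rewrite -wP; apply/negP => /yD'[]; by [].
case: (leqP a m) => am.
  rewrite /part (nth_map 0) ?size_iota ?nth_iota; try lia.
  by rewrite add1n prednK.
rewrite /part nth_default ?size_map ?size_iota; last by lia.
have /eqP -> : w a == 0 by rewrite -leqn0 leqNgt wpos // -ltnNge.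
by [].
Qed.

Lemma in_removable_nodes (D : {fset node}) (x : node) :
  (x \in removable_nodes D) = (x \in D) && young (D `\ x).
Proof. by rewrite !inE. Qed.

Lemma in_indent_nodes (D : {fset node}) (x : node) :
  (x \in indent_nodes D) = (x \notin D) && young (x |` D).
Proof.
have sepE (A : {fset node}) (P : pred node) :
  (x \in [fset y in A | P y]) = (x \in A) && P x by rewrite !inE.
rewrite sepE {sepE} andb_idl // => /andP[xD /youngE yD].
have [x1 x2 lx] := yD x (fset1U1 x D).
case: x x1 x2 xD yD lx => -[|[|a]] [|[|b]] //= _ _ xD yD lx.
- by rewrite !inE eqxx.
- rewrite !in_fsetU; apply/orP; right; apply/orP; right.
  apply/imfsetP; exists (1, b.+1) => //=.
  have := lx (1, b.+1); rewrite in_fset1U /= => /(_ isT); rewrite ltnW // => /(_ isT).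
  by rewrite xpair_eqE /=; case: eqP => [|_ //]; lia.
- rewrite !in_fsetU; apply/orP; right; apply/orP; left.
  apply/imfsetP; exists (a.+1, 1) => //=.
  have := lx (a.+1, 1); rewrite in_fset1U /= leqnSn => /(_ isT isT).
  by rewrite xpair_eqE andbT; case: eqP => [|_ //]; lia.
- rewrite !in_fsetU; apply/orP; right; apply/orP; left.
  apply/imfsetP; exists (a.+1, b.+2) => //=.
  have := lx (a.+1, b.+2); rewrite in_fset1U /= leqnSn leqnn => /(_ isT isT).
  by rewrite xpair_eqE; case: eqP => [|_ //]; lia.
Qed.

(* Main.v *)
Require Import Defs.
From mathcomp Require Import zify.

(** Let [r = r_i] and [c = part lam r].  Since the row [r] ends at the removable
node [(r, c)], the column [c] has exactly [r] nodes, so for [a < r] the hook of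
[(a, c)] has length [H = (part lam a - c) + (r - a) + 1].  Modulo [l] this reads:
[l] divides [H] iff the node [(a, part lam a + 1)] just beyond the end of row [a]
has the residue of [(r, c)] ([residue_indent_hook]), and [l] divides [H - 1] iff
the last node [(a, part lam a)] of row [a] has it ([residue_end_hook]).

On the algebraic side, [q_int h] is [('X^h - 1) / ('X - 1)]; as ['X^h - 1] is
squarefree and ['Phi_l] with [l > 1] is irreducible and prime to ['X - 1], the
valuation of [q_int h] is 1 or 0 according as [l] divides [h] or not
([poly_mult_q_poly]).  Hence the valuation of the product over [a < r] is
the number of rows [a < r] with [(a, part lam a + 1)] of residue [k] minus the
number of those with [(a, part lam a)] of residue [k].

These counts ignore whether the nodes are indent, respectively removable.  The
end of row [a] fails to be removable exactly when [part lam a.+1 = part lam a],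
which is exactly when the node beyond row [a.+1] fails to be an indent node; both
nodes then lie on one diagonal, have equal residues and cancel
([sum_adjacent_cancel]).  The node [(r, c + 1)] could disturb this at the boundary:
it is the partner of the end of row [r - 1] if it is not an indent node, and is to
the right of [(r, c)] if it is one.  Its residue is [k + 1], though, which differs
from [k] as [l > 1], so it never counts.  What remains is the number of indent minus
the number of removable k-nodes in rows above [r], which are the ones to the right
of [(r, c)]. *)

Import GRing.Theory Num.Theory.

Local Open Scope ring_scope.

(** * The valuation at a prime polynomial *)

Implicit Types (P f g : {poly rat}).

(** Primality in place of irreducibility: the additivity of multiplicities uses
it, and minimal polynomials have it by their defining property. *)
Definition prime_poly (P : {poly rat}) : Prop :=
  (1 < size P)%N /\ forall f g, P %| f * g -> (P %| f) || (P %| g).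

(** The multiplicity is a maximum over exponents below [size f]; the bound does
not truncate it because [size (P ^+ e) > e]. *)
Lemma poly_mult_eq P e g : (1 < size P)%N -> ~~ (P %| g) ->
  poly_mult P (P ^+ e * g) = e.
Proof.
move=> P1 Pg.
have P0 : P != 0 by rewrite -size_poly_gt0 ltnW.
have g0 : g != 0 by apply: contraNneq Pg => ->; apply: dvdp0.
apply/eqP; rewrite eqn_leq; apply/andP; split.
  apply/bigmax_leqP => -[e' /= _] Pe'; rewrite leqNgt; apply: contra Pg => ee'.
  by rewrite -(dvdp_mul2l _ _ (expf_neq0 e P0)) -exprSr (dvdp_trans _ Pe')
    ?dvdp_exp2l.
have esize : (e < size (P ^+ e * g)%R)%N.
  apply: (leq_trans _ (dvdp_leq _ (dvdp_mulIl (P ^+ e) g))).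
    have Pe0 : (0 < size (P ^+ e)%R)%N by rewrite size_poly_gt0 expf_neq0.
    by rewrite -(prednK Pe0) size_exp ltnS leq_pmull // -ltnS prednK // ltnW.
  by rewrite mulf_neq0 ?expf_neq0.
exact: (leq_bigmax_cond (Ordinal esize) (dvdp_mulIl _ _)).
Qed.

Lemma poly_mult_decomp P f : (1 < size P)%N -> f != 0 ->
  exists2 g, ~~ (P %| g) & f = P ^+ poly_mult P f * g.
Proof.
move=> P1 f0; suff [e [g Pg fE]] : exists e, exists2 g, ~~ (P %| g) & f = P ^+ e * g.
  by exists g => //; rewrite {2}fE poly_mult_eq.
have P0 : P != 0 by rewrite -size_poly_gt0 ltnW.
have [n] := ubnP (size f); elim: n f f0 => // n IHn f f0 fn.
have [/dvdpP[g fE] | Pf] := boolP (P %| f); last by exists 0%N, f; rewrite ?mul1r.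
have g0 : g != 0 by apply: contraNneq f0 => g0; rewrite fE g0 mul0r.
have [|e [h Ph gE]] := IHn g g0.
  move: fn; rewrite fE size_mul //.
  by move: P1 g0; rewrite -size_poly_gt0; move: (size g) (size P) => a b; lia.
by exists e.+1, h; rewrite // fE gE exprSr mulrAC.
Qed.

Lemma poly_multM P f g : prime_poly P -> f != 0 -> g != 0 ->
  poly_mult P (f * g) = (poly_mult P f + poly_mult P g)%N.
Proof.
move=> [P1 Pp] f0 g0.
have [f' Pf' fE] := poly_mult_decomp P _ P1 f0.
have [g' Pg' gE] := poly_mult_decomp P _ P1 g0.
rewrite {1}fE {1}gE mulrACA -exprD poly_mult_eq //.
by apply/negP => /Pp; rewrite (negPf Pf') (negPf Pg').
Qed.

(** [val_at] reads a fraction through its chosen representative, which need not be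
in lowest terms; this equation is what gives access to it. *)
Lemma tofrac_repr (x : Qq) : tofrac \d_(repr x) * x = tofrac \n_(repr x).
Proof.
rewrite -{2}[x]reprK; move: (repr x) => y; unlock tofrac.
rewrite -[LHS]FracField.pi_mul; apply/eqmodP; rewrite /= FracField.equivfE.
by rewrite !numden_Ratio ?mulf_neq0 ?oner_neq0 ?denom_ratioP //= !mulr1 mul1r.
Qed.

(** Two representatives of a fraction are related by cross-multiplication, which
the additivity of multiplicities turns into equal differences. *)
Lemma val_at_frac P n d : prime_poly P -> n != 0 -> d != 0 ->
  val_at P (tofrac n / tofrac d) = (poly_mult P n)%:Z - (poly_mult P d)%:Z.
Proof.
move=> Pp n0 d0; rewrite /val_at; set x := tofrac n / tofrac d.
have dx0 : \d_(repr x) != 0 by apply: denom_ratioP.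
have eqx : \d_(repr x) * n = \n_(repr x) * d.
  apply/eqP; rewrite -tofrac_eq !tofracM -tofrac_repr -mulrA /x divfK //.
  by rewrite tofrac_eq0.
have nx0 : \n_(repr x) != 0.
  have := mulf_neq0 dx0 n0; rewrite eqx.
  by apply: contraNneq => ->; rewrite mul0r.
have := congr1 (poly_mult P) eqx; rewrite !poly_multM //.
move: (poly_mult P _) (poly_mult P _) (poly_mult P _) (poly_mult P _); lia.
Qed.

Lemma Qq_frac (x : Qq) : x != 0 ->
  exists n d, [/\ n != 0, d != 0 & x = tofrac n / tofrac d].
Proof.
move=> x0; have d0 : \d_(repr x) != 0 by apply: denom_ratioP.
have td0 : tofrac \d_(repr x) != 0 by rewrite tofrac_eq0.
exists \n_(repr x), \d_(repr x); split=> //.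
  by have := mulf_neq0 td0 x0; rewrite tofrac_repr tofrac_eq0.
by rewrite -tofrac_repr mulrC mulKf.
Qed.

Lemma val_at1 P : val_at P 1 = 0.
Proof.
rewrite /val_at; have := tofrac_repr 1; rewrite mulr1 => /eqP.
by rewrite tofrac_eq => /eqP ->; rewrite subrr.
Qed.

Lemma val_atM P (x y : Qq) : prime_poly P -> x != 0 -> y != 0 ->
  val_at P (x * y) = val_at P x + val_at P y.
Proof.
move=> Pp /Qq_frac[a [b [a0 b0 ->]]] /Qq_frac[c [d [c0 d0 ->]]].
rewrite mulrACA -invfM -!tofracM !val_at_frac ?mulf_neq0 // !poly_multM //; lia.
Qed.

Lemma val_at_prod P (r : seq nat) (F : nat -> Qq) : prime_poly P ->
  {in r, forall a, F a != 0} ->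
  val_at P (\prod_(a <- r) F a) = \sum_(a <- r) val_at P (F a).
Proof.
move=> Pp; elim: r => [|a r IHr] F0; first by rewrite !big_nil val_at1.
have F0' : {in r, forall a, F a != 0}.
  by move=> b br; apply: F0; rewrite inE br orbT.
rewrite !big_cons val_atM ?IHr ?F0 ?mem_head //.
by rewrite prodf_seq_neq0; apply/allP.
Qed.

(** ['Phi_l] is the minimal polynomial over the rationals of any primitive [l]-th
root of unity, so divisibility by it can be tested by evaluation; in particular
it is prime. *)
Lemma Phi_root l (z : algC) f : l.-primitive_root z ->
  root (map_poly ratr f) z = (Phi_rat l %| f).
Proof.
move=> zl; have [p [pE _] ->] := minCpolyP z.
congr (_ %| _); apply: (@map_poly_inj _ _ (ratr : rat -> algC)).
rewrite -pE (minCpoly_cyclotomic zl) -(Cintr_Cyclotomic zl).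
by rewrite /Phi_rat -map_poly_comp; apply: eq_map_poly => a /=; rewrite ratr_int.
Qed.

Lemma Phi_prime l : (0 < l)%N -> prime_poly (Phi_rat l).
Proof.
move=> l0; have [z zl] := C_prim_root_exists l0; split.
  rewrite size_map_inj_poly ?size_Cyclotomic ?ltnS ?totient_gt0 //.
  exact: intr_inj.
by move=> f g; rewrite -!(Phi_root l z _ zl) rmorphM rootM.
Qed.

(** * The valuation of quantum integers *)

Definition q_poly (h : nat) : {poly rat} := \sum_(j < h) 'X^j.

Lemma q_intE h : q_int h = tofrac (q_poly h).
Proof.
by rewrite /q_int big_mkord rmorph_sum; apply: eq_bigr => j _; rewrite rmorphXn.
Qed.

Lemma q_poly_neq0 h : (0 < h)%N -> q_poly h != 0.
Proof.
move=> h0; have := monic_neq0 (monicXnsubC (1 : rat) h0).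
by rewrite subrX1 mulf_eq0 negb_or => /andP[].
Qed.

(** A primitive [l]-th root of unity [z] is a root of ['X^h - 1] iff [l] divides
[h], and then a simple root: a square factor ['Phi_l ^+ 2] would divide the
derivative of ['X^h - 1] as well, which does not vanish at [z]. *)
Lemma poly_mult_q_poly l h : (1 < l)%N -> (0 < h)%N ->
  poly_mult (Phi_rat l) (q_poly h) = (l %| h)%N.
Proof.
move=> l1 h0; have [z zl] := C_prim_root_exists (ltnW l1).
have [P1 Pp] := Phi_prime l (ltnW l1).
have z1 : z - 1 != 0.
  by rewrite subr_eq0 -(expr1 z) -(prim_order_dvd zl) dvdn1; lia.
have rX (n : nat) : (map_poly ratr 'X^n : {poly algC}) = 'X^n.
  by rewrite rmorphXn /= map_polyX.
have Phi_dvd : (Phi_rat l %| q_poly h) = (l %| h)%N.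
  rewrite -(Phi_root l z _ zl) (prim_order_dvd zl) -subr_eq0 subrX1 mulf_eq0.
  rewrite (negPf z1) /=.
  rewrite rmorph_sum /root horner_sum /=; congr (_ == 0).
  by apply: eq_bigr => j _; rewrite rX hornerXn.
have [lh | lh] := boolP (l %| h)%N; last first.
  by have := poly_mult_eq _ 0 (q_poly h) P1; rewrite mul1r Phi_dvd => ->.
move: Phi_dvd; rewrite lh => /dvdpP[g gE].
rewrite gE mulrC -[X in X * g]expr1 poly_mult_eq //; apply/negP => Pg.
have /dvdpP[u uE] : Phi_rat l ^+ 2 %| 'X^h - 1.
  by rewrite subrX1 -/(q_poly h) gE dvdp_mull // expr2 mulrC dvdp_mul.
have : Phi_rat l %| ('X^h - 1)^`().
  rewrite uE derivM deriv_exp expr1 dvdp_add //; first by rewrite dvdp_mull ?dvdp_exp.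
  by rewrite -mulrnAl mulrA dvdp_mulIr.
rewrite derivB derivXn derivC subr0 -(Phi_root l z _ zl) rmorphMn /= rX.
rewrite /root hornerMn hornerXn mulrn_eq0 expf_eq0.
have /negPf -> : z != 0.
  apply: contra_eqN (prim_expr_order zl) => /eqP ->.
  by rewrite expr0n eq_sym gtn_eqF ?oner_eq0 // ltnW.
by rewrite andbF; lia.
Qed.

Lemma val_at_q_ratio l h : (1 < l)%N -> (1 < h)%N ->
  val_at (Phi_rat l) (q_int h / q_int (h - 1))
    = (l %| h)%N%:Z - (l %| h - 1)%N%:Z.
Proof.
move=> l1 h1; rewrite !q_intE val_at_frac ?q_poly_neq0 ?poly_mult_q_poly //; try lia.
exact: Phi_prime l (ltnW l1).
Qed.

Local Open Scope fset_scope.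

(** * Corners of a diagram and hooks above a corner *)

Lemma card_fset_seq (T : choiceType) (A : {fset T}) (s : seq T) :
  uniq s -> A =i s -> #|` A| = size s.
Proof. by move=> us As; apply/perm_size/uniq_perm. Qed.

Lemma in_fset_sep (T : choiceType) (A : {fset T}) (p : pred T) (x : T) :
  (x \in [fset y in A | p y]) = (x \in A) && p x.
Proof. by rewrite !inE. Qed.

Lemma removable_nodeE lam (x : node) : is_partition lam ->
  (x \in removable_nodes (diagram lam))
    = [&& 0 < x.1, 0 < x.2, x.2 == part lam x.1 & part lam x.1.+1 < x.2]%N.
Proof.
move=> plam; rewrite in_removable_nodes mem_diagram; case: x => a b /=.
apply/andP/and4P => [[/and3P[a0 b0 bl] /youngE yD] | [a0 b0 /eqP bE lb]].
  split=> //.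
  - rewrite eqn_leq bl leqNgt; apply/negP => lb.
    have abD : (a, b.+1) \in diagram lam `\ (a, b).
      by rewrite in_fsetD1 mem_diagram xpair_eqE /= a0 lb; lia.
    have [/= _ _ /(_ (a, b))] := yD _ abD.
    by rewrite /= a0 b0 leqnn leqnSn in_fsetD1 eqxx => /(_ isT isT).
  - rewrite ltnNge; apply/negP => lb.
    have abD : (a.+1, b) \in diagram lam `\ (a, b).
      by rewrite in_fsetD1 mem_diagram xpair_eqE /= b0 lb; lia.
    have [/= _ _ /(_ (a, b))] := yD _ abD.
    by rewrite /= a0 b0 leqnn leqnSn in_fsetD1 eqxx => /(_ isT isT).
split; first by rewrite a0 b0 bE /=.
apply/youngE => -[a' b']; rewrite in_fsetD1 mem_diagram xpair_eqE /=.
move=> /and4P[ab' a'0 b'0 bl']; split=> // -[a2 b2] /= /andP[a20 a2l] /andP[b20 b2l].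
rewrite in_fsetD1 mem_diagram xpair_eqE /= a20 b20 /=.
have := @part_anti lam a2 a' plam; rewrite a20 a2l => /(_ isT) aa.
rewrite (leq_trans b2l (leq_trans bl' aa)) andbT.
apply: contra ab' => /andP[/eqP a2E /eqP b2E]; subst a2 b2.
have [aa' | aa'] := ltnP a a'.
  by have := @part_anti lam a.+1 a' plam; rewrite aa' /= => /(_ isT); lia.
have a'E : a' = a by lia.
by move: bl' b2l; rewrite bE a'E eqxx; lia.
Qed.

Lemma removable_row_corner lam i : is_partition lam ->
  (1 <= i <= size (removable_rows lam))%N ->
  [/\ 0 < removable_row lam i, 0 < part lam (removable_row lam i)
    & part lam (removable_row lam i).+1 < part lam (removable_row lam i)]%N.
Proof.
move=> plam /andP[i0 il].
have : removable_row lam i \in removable_rows lam by rewrite mem_nth // prednK.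
rewrite mem_filter => /andP[/hasP[b _]]; rewrite removable_nodeE //=.
by case/and4P=> r0 b0 /eqP <- lb _.
Qed.

(** As [part lam 0] is [part lam 1], the comparison with the row above would
reject row 1, which always admits a node. *)
Definition addable_row (lam : seq nat) (a : nat) : bool :=
  (a == 1)%N || (part lam a < part lam a.-1)%N.

Lemma indent_nodeE lam (x : node) : is_partition lam ->
  (x \in indent_nodes (diagram lam))
    = [&& 0 < x.1, x.2 == (part lam x.1).+1 & addable_row lam x.1]%N.
Proof.
move=> plam; rewrite in_indent_nodes mem_diagram; case: x => a b /=.
rewrite /addable_row.
apply/andP/and3P => [[abD /youngE yD] | [a0 /eqP bE add_a]].
  have [/= a0 b0 lab] := yD _ (fset1U1 (a, b) (diagram lam)).
  move: abD; rewrite a0 b0 /= -ltnNge => lb; split=> //.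
  - rewrite eqn_leq lb andbT; have [//|b1] := leqP b 1; first by lia.
    have := lab (a, b.-1); rewrite /= a0 leqnn in_fset1U mem_diagram xpair_eqE /=.
    by move=> /(_ isT); lia.
  - have [//|a1] := eqVneq a 1%N.
    have := lab (a.-1, b); rewrite /= b0 leqnn in_fset1U mem_diagram xpair_eqE /=.
    move=> h; have := h _ isT; lia.
split; first by rewrite bE; lia.
apply/youngE => -[a' b']; rewrite in_fset1U mem_diagram xpair_eqE /= => h.
have h' : [/\ 0 < a', 0 < b' & (b' <= part lam a') || ((a' == a) && (b' == b))]%N.
  by split; lia.
case: h' => a'0 b'0 bl'; split=> // -[a2 b2] /= /andP[a20 a2l] /andP[b20 b2l].
rewrite in_fset1U mem_diagram xpair_eqE /= a20 b20 /=.
have := @part_anti lam a2 a' plam; rewrite a20 a2l => /(_ isT) aa.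
case/orP: bl' => [bl' | /andP[/eqP a'E /eqP b'E]].
  by rewrite (leq_trans b2l (leq_trans bl' aa)) orbT.
subst a' b'; have [a2E | a2n] := eqVneq a2 a; first by subst a2; lia.
have := @part_anti lam a2 a.-1 plam; lia.
Qed.

(** The last node of row [r] being removable, the column through it stops at row
[r]; this gives the leg length [r - a]. *)
Lemma hook_length_corner lam r a : is_partition lam ->
  (0 < a < r)%N -> (0 < part lam r)%N -> (part lam r.+1 < part lam r)%N ->
  hook_length lam (a, part lam r)
    = (part lam a - part lam r + (r - a) + 1)%N.
Proof.
move=> plam /andP[a0 ar]; set c := part lam r => c0 lr.
have ca : (c <= part lam a)%N by apply: part_anti; rewrite // a0 ltnW.
(* The corner [(a, c)] of the hook is counted in its arm. *)
pose arm := [seq (a, b) | b <- iota c (part lam a - c).+1] : seq node.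
pose leg := [seq (b, c) | b <- iota a.+1 (r - a)] : seq node.
rewrite /hook_length (@card_fset_seq _ _ (arm ++ leg)).
- by rewrite size_cat !size_map !size_iota; lia.
- rewrite cat_uniq !map_inj_uniq ?iota_uniq ?andbT /=; last 2 first.
  + by move=> x y [].
  + by move=> x y [].
  apply/hasPn => z /mapP[x]; rewrite mem_iota => xa ->; apply/mapP => -[y _ [xE _]].
  by move: xa; rewrite xE ltnn.
case=> x y; rewrite mem_cat.
have -> : ((x, y) \in arm) = [&& x == a, c <= y & y <= part lam a]%N.
  apply/mapP/and3P => [[z] | [/eqP-> cy ya]].
    by rewrite mem_iota => h [-> ->]; split; lia.
  by exists y; rewrite // mem_iota; lia.
have -> : ((x, y) \in leg) = [&& y == c, a < x & x <= r]%N.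
  apply/mapP/and3P => [[z] | [/eqP-> cy ya]].
    by rewrite mem_iota => h [-> ->]; split; lia.
  by exists x; rewrite // mem_iota; lia.
rewrite in_fset_sep mem_diagram /=.
have [xa /= | xna] := eqVneq x a.
  by subst x; rewrite ltnn /= !andbF orbF; lia.
have [yc | ync] := eqVneq y c; last by rewrite !andbF.
subst y; rewrite /= c0 /=.
have [xr | rx] := leqP x r.
  have [ax|xa] := leqP a x; last by rewrite andbF; lia.
  have -> : (c <= part lam x)%N by apply: part_anti; rewrite // xr andbT; lia.
  lia.
have : (part lam x <= part lam r.+1)%N by apply: part_anti.
lia.
Qed.

(** * Residues and hook lengths *)

Lemma residue_eq l a b a' b' : (1 < l)%N ->
  (residue l (a, b) == residue l (a', b')) = (b + a' == b' + a %[mod l])%N.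
Proof.
move=> l1; rewrite /residue /= subr_eq addrAC eq_sym subr_eq -!natrD.
by rewrite -(inj_eq val_inj) /= !val_Zp_nat // eq_sym.
Qed.

Lemma residue_diagonal l a b : residue l (a.+1, b.+1) = residue l (a, b).
Proof. by rewrite /residue /= -!natr1 opprD addrACA subrr addr0. Qed.

Lemma residue_next_neq l a b : (1 < l)%N ->
  (residue l (a, b.+1) == residue l (a, b)) = false.
Proof.
move=> l1; rewrite residue_eq // addSn -addn1 -{2}[(b + a)%N]addn0 eqn_modDl.
by rewrite modn_small // mod0n.
Qed.

(** With [c = part lam r], the residues agree iff
[part lam a + 1 - a = c - r] modulo [l], and the difference of the two sides is
the hook length. *)
Lemma residue_indent_hook l lam r a : is_partition lam -> (1 < l)%N ->
  (0 < a < r)%N -> (0 < part lam r)%N -> (part lam r.+1 < part lam r)%N ->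
  (residue l (a, (part lam a).+1) == residue l (r, part lam r))
    = (l %| hook_length lam (a, part lam r))%N.
Proof.
move=> plam l1 ar c0 lr; rewrite residue_eq // hook_length_corner //.
have ca : (part lam r <= part lam a)%N by apply: part_anti; lia.
by rewrite eqn_mod_dvd; [congr (_ %| _)%N|]; lia.
Qed.

Lemma residue_end_hook l lam r a : is_partition lam -> (1 < l)%N ->
  (0 < a < r)%N -> (0 < part lam r)%N -> (part lam r.+1 < part lam r)%N ->
  (residue l (a, part lam a) == residue l (r, part lam r))
    = (l %| hook_length lam (a, part lam r) - 1)%N.
Proof.
move=> plam l1 ar c0 lr; rewrite residue_eq // hook_length_corner //.
have ca : (part lam r <= part lam a)%N by apply: part_anti; lia.
by rewrite eqn_mod_dvd; [congr (_ %| _)%N|]; lia.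
Qed.

(** * Counting nodes to the right *)

(** Indent and removable nodes are determined by their rows, so they are counted
by rows. *)
Lemma count_rows (f : nat -> node) (A : {fset node}) (p : pred nat) r :
  (forall a, (f a).1 = a) ->
  (forall x, (x \in A) = [&& 0 < x.1, x.1 < r, x == f x.1 & p x.1]%N) ->
  #|` A| = (\sum_(1 <= a < r) p a)%N.
Proof.
move=> f1 AE; rewrite (@card_fset_seq _ _ [seq f a | a <- iota 1 (r - 1) & p a]).
- by rewrite size_map size_filter -sum1_count /index_iota -big_mkcond.
- by rewrite map_inj_uniq ?filter_uniq ?iota_uniq // => x y /(congr1 fst); rewrite !f1.
move=> x; rewrite AE; apply/and4P/mapP => [[x0 xr /eqP xE px] | [a]].
  by exists x.1; rewrite // mem_filter px mem_iota; lia.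
rewrite mem_filter mem_iota => /andP[pa ar] ->; rewrite f1 pa eqxx; split=> //; lia.
Qed.

Lemma right_of_gt lam mu (x y : node) :
  diagram lam `\` diagram mu = [fset y] -> right_of lam mu x = (y.2 < x.2)%N.
Proof.
move=> dE; rewrite /right_of dE; apply/allP/idP => [| yx z /fset1P -> //].
by apply; apply: fset11.
Qed.

(** Row [r] may also contribute an indent node to the right of [(r, part lam r)],
but its residue is off by one; in the rows below [r] all nodes lie to the left. *)
Lemma I_right_sum l lam mu r : is_partition lam -> (1 < l)%N ->
  (0 < r)%N -> (part lam r.+1 < part lam r)%N ->
  diagram lam `\` diagram mu = [fset (r, part lam r)] ->
  I_right (residue l (r, part lam r)) lam mu
    = (\sum_(1 <= a < r) (addable_row lam a
         && (residue l (a, (part lam a).+1) == residue l (r, part lam r))))%N.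
Proof.
move=> plam l1 r0 lr dE.
apply: (@count_rows (fun a => (a, (part lam a).+1))) => // -[a b].
rewrite in_fset_sep indent_nodeE // (right_of_gt _ _ _ _ dE) xpair_eqE.
rewrite eqxx /=; have [bE | bn] := eqVneq b (part lam a).+1; last by rewrite !andbF.
subst b; have [-> // | a0] := posnP a; case: (addable_row lam a); rewrite ?andbF //=.
have [resE | //] := boolP (_ == _); rewrite ?andbF //= andbT ltnS.
have [ar | ra | aE] := ltngtP a r.
- by apply: part_anti; rewrite // a0 ltnW.
- by apply/negbTE; rewrite -ltnNge (leq_ltn_trans _ lr) // part_anti.
- by move: resE; rewrite aE residue_next_neq.
Qed.

(** A removable node in a row [a < r] is strictly to the right, since
[part lam a > part lam a.+1 >= part lam r]. *)
Lemma R_right_sum l lam mu r : is_partition lam ->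
  (0 < r)%N -> (0 < part lam r)%N ->
  diagram lam `\` diagram mu = [fset (r, part lam r)] ->
  R_right (residue l (r, part lam r)) lam mu
    = (\sum_(1 <= a < r) ((part lam a.+1 < part lam a)
         && (residue l (a, part lam a) == residue l (r, part lam r))))%N.
Proof.
move=> plam r0 c0 dE.
apply: (@count_rows (fun a => (a, part lam a))) => // -[a b].
rewrite in_fset_sep removable_nodeE // (right_of_gt _ _ _ _ dE) xpair_eqE.
rewrite eqxx /=; have [bE | bn] := eqVneq b (part lam a); last by rewrite !andbF.
subst b; have [-> // | a0] := posnP a; case: (_ == _); rewrite ?andbF //= !andbT.
have [la | _] := ltnP (part lam a.+1) (part lam a); last by rewrite !andbF.
rewrite (leq_ltn_trans _ la) //= andbT; have [ar | ra] := ltnP a r.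
  by apply: leq_ltn_trans la; apply: part_anti.
by apply/negbTE; rewrite -leqNgt part_anti // r0.
Qed.

(** * Cancellation of adjacent rows *)

(** Dropping the conditions [add] and [rem] adds to the left-hand side the terms
[t a = ~~ add a && f a] and removes the terms [~~ rem a && g a = t a.+1], so the
error telescopes to [t 1 - t r], and both boundary terms vanish. *)
Lemma sum_adjacent_cancel (add f g rem : nat -> bool) r :
  (0 < r)%N -> add 1%N -> ~~ f r ->
  (forall a, (0 < a)%N -> rem a = add a.+1) ->
  (forall a, (0 < a)%N -> ~~ rem a -> f a.+1 = g a) ->
  (\sum_(1 <= a < r) (add a && f a))%N%:Z
     - (\sum_(1 <= a < r) (rem a && g a))%N%:Z
    = (\sum_(1 <= a < r) ((f a)%:Z - (g a)%:Z))%R :> int.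
Proof.
move=> r0 add1 fr remE fg; apply/eqP; rewrite -subr_eq0.
pose t a := (~~ add a && f a : nat)%:Z.
rewrite !(big_morph Posz PoszD (erefl _)) -!sumrB.
apply/eqP; transitivity (\sum_(1 <= a < r) (t a.+1 - t a))%R; last first.
  rewrite telescope_sumr // /t add1 /=.
  by rewrite (negPf fr) andbF.
apply: eq_big_nat => a /andP[a0 _].
move: (fg a a0); rewrite /t remE //.
by case: (add a); case: (add _); case: (f a); case: (f _); case: (g a) => //= /(_ isT).
Qed.

(** * The comparison *)

Theorem theorem1 (l n : nat) (lam mu : seq nat) (i : nat) (gamma : node)
    (k : 'Z_l) :
  (2 <= l)%N ->
  is_partition lam -> sumn lam = n ->
  (1 <= i <= size (removable_rows lam))%N ->
  gamma = (removable_row lam i, part lam (removable_row lam i)) ->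
  is_partition mu ->
  diagram mu `<=` diagram lam ->
  diagram lam `\` diagram mu = [fset gamma] ->
  k = residue l gamma ->
  N_right k lam mu = nu_q_m2 l lam i.
Proof.
move=> l1 plam _ il -> _ _ dE ->.
have [] := removable_row_corner lam i plam il; rewrite /nu_q_m2.
move: (removable_row lam i) dE => r dE r0 c0 lr.
have ca a : (0 < a < r)%N -> (part lam r <= part lam a)%N.
  by move=> ar; apply: part_anti; lia.
have hook1 a : (0 < a < r)%N -> (1 < hook_length lam (a, part lam r))%N.
  by move=> ar; have := ca a ar; rewrite hook_length_corner //; lia.
have q_int_neq0 h : (0 < h)%N -> q_int h != 0%R.
  by move=> h0; rewrite q_intE tofrac_eq0 q_poly_neq0.
rewrite val_at_prod; first last.
- move=> a; rewrite mem_index_iota => /hook1 h1.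
  by rewrite mulf_neq0 ?invr_eq0 ?q_int_neq0 //; lia.
- exact: Phi_prime (ltnW l1).
rewrite /N_right I_right_sum // R_right_sum // sum_adjacent_cancel //.
- apply: eq_big_nat => a ar.
  rewrite val_at_q_ratio ?hook1 //.
  by rewrite residue_indent_hook ?residue_end_hook.
- by rewrite residue_next_neq.
- by case.
move=> [|a] // _; rewrite -leqNgt => la.
have lE : part lam a.+2 = part lam a.+1.
  by apply/eqP; rewrite eqn_leq la part_anti // leqnSn.
by rewrite lE residue_diagonal.
Qed.
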